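(* There exist a pair $(L_0,L_1)\in\mathcal{W}$ and two $\sigma$-invariant Borel probability measures $\mu,\nu$ on $\Sigma_2$ such that $\mu$ and $\nu$ have the same support, but $\mu$ is a maximising measure of $(L_0,L_1)$ and $\nu$ is not.
   Context: Let $\mathcal{H}$ be a real separable Hilbert space with orthonormal basis $\{e_i: i\in\mathbb{Z}\}$, and let $\mathcal{B}(\mathcal{H})$ be the bounded linear operators on $\mathcal{H}$ with the operator norm topology. A weighted shift operator is a bounded linear operator $L$ on $\mathcal{H}$ such that $Le_i=\alpha_i e_{i+1}$ for all $i\in\mathbb{Z}$, for some real coefficients $\alpha_i$. $\mathcal{W}\subset\mathcal{B}(\mathcal{H})^2$ denotes the set of all pairs $(L_0,L_1)$ of bounded, invertible weighted shift operators with positive coefficients (so each coefficient sequence is bounded and bounded away from zero). $\Sigma_2=\{0,1\}^{\mathbb{Z}}$ has the product topology and $\sigma[(x_i)_{i\in\mathbb{Z}}]=(x_{i+1})_{i\in\mathbb{Z}}$. $\mathcal{M}_\sigma$ is the set of $\sigma$-invariant Borel probability measures on $\Sigma_2$. For $(L_0,L_1)\in\mathcal{W}$, the joint spectral radius is $\varrho(L_0,L_1)=\lim_{n\to\infty}\sup_{x_1,\dots,x_n\in\{0,1\}}\|L_{x_n}\cdots L_{x_1}\|^{1/n}$. A measure $\mu\in\mathcal{M}_\sigma$ is a maximising measure of $(L_0,L_1)$ if $\lim_{n\to\infty}\frac1n\int\log\|L_{x_n}\cdots L_{x_1}\|\,d\mu(x)=\log\varrho(L_0,L_1)$. *)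

(* Defs.v *)
From HB Require Import structures.
From mathcomp Require Import all_boot all_order all_algebra.
From mathcomp Require Import all_classical all_reals all_analysis.

Set Implicit Arguments.
Unset Strict Implicit.
Unset Printing Implicit Defensive.

Import Order.TTheory GRing.Theory Num.Theory.
Import numFieldNormedType.Exports.

Local Open Scope classical_set_scope.
Local Open Scope ring_scope.

(* Together with [completeNormedModType], this says that [H] is a real Hilbert
   space: its (complete) norm is the one induced by the inner product [ip]. *)
Definition inner_product_norm (R : realType) (H : completeNormedModType R)
    (ip : {dot H for idfun}) : Prop :=
  forall x : H, `|x| ^+ 2 = ip x x.

(* Separability of [H] follows from the countability of the index type. *)
Definition orthonormal_basis (R : realType) (H : completeNormedModType R)
    (ip : {dot H for idfun}) (e : int -> H) : Prop :=
  (forall i j : int, ip (e i) (e j) = (i == j)%:R) /\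
  dense [set x : H | exists (s : seq int) (c : int -> R),
                       x = \sum_(i <- s) c i *: e i].

Section Operators.
Context {R : realType} {H : completeNormedModType R}.

Definition bounded_op (L : H -> H) : Prop :=
  exists M : R, forall x : H, `|L x| <= M * `|x|.

Definition opnorm (L : H -> H) : R :=
  sup [set `|L x| | x in [set x : H | `|x| <= 1]].

(* Invertibility in the algebra of bounded linear operators. *)
Definition invertible_op (L : {linear H -> H}) : Prop :=
  exists M : {linear H -> H}, [/\ bounded_op M, cancel L M & cancel M L].

Definition weighted_shift (e : int -> H) (alpha : int -> R)
    (L : {linear H -> H}) : Prop :=
  bounded_op L /\ forall i : int, L (e i) = alpha i *: e (i + 1).

Definition positive_invertible_shift (e : int -> H) (L : {linear H -> H}) :
    Prop :=
  invertible_op L /\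
  exists alpha : int -> R, (forall i, 0 < alpha i) /\ weighted_shift e alpha L.

Definition calW (e : int -> H) : set ({linear H -> H} * {linear H -> H}) :=
  [set L | positive_invertible_shift e L.1 /\ positive_invertible_shift e L.2].

(* For [w = [:: x1; ...; xn]] this is the product L_{xn} ... L_{x1}: the
   operator indexed by the head of [w] acts first; [false] codes the symbol 0
   and [true] the symbol 1. *)
Definition word_op (L : {linear H -> H} * {linear H -> H}) (w : seq bool) :
    H -> H :=
  fun v => foldl (fun u b => if b then L.2 u else L.1 u) v w.

Definition joint_spectral_radius (L : {linear H -> H} * {linear H -> H}) : R :=
  limn (fun n : nat =>
    sup [set opnorm (word_op L w) `^ n%:R^-1 | w in [set: n.-tuple bool]]).

End Operators.

Definition Sigma2 := prod_topology (fun _ : int => bool).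

Definition sigma_shift (x : Sigma2) : Sigma2 := fun i : int => x (i + 1).

Definition borelSigma2 := g_sigma_algebraType (@open Sigma2).

(* The finite word x_1 ... x_n of a bi-infinite sequence x. *)
Definition word (x : Sigma2) (n : nat) : seq bool :=
  [seq x i%:Z | i <- iota 1 n].

Section Measures.
Context {R : realType}.

Definition shift_invariant (mu : probability borelSigma2 R) : Prop :=
  forall A : set borelSigma2, measurable A -> mu (sigma_shift @^-1` A) = mu A.

Definition msupport (mu : probability borelSigma2 R) : set Sigma2 :=
  [set x | forall U : set Sigma2, open U -> U x -> (0 < mu U)%E].

Definition maximising_measure (H : completeNormedModType R)
    (L : {linear H -> H} * {linear H -> H}) (mu : probability borelSigma2 R) :
    Prop :=
  shift_invariant mu /\
  (n%:R^-1 * \int[mu]_x ln (opnorm (word_op L (word x n)))) @[n --> \oo]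
    --> ln (joint_spectral_radius L).

End Measures.

(* Main.v *)
Require Import Defs.
From HB Require Import structures.
From mathcomp Require Import all_boot all_order all_algebra.
From mathcomp Require Import all_classical all_reals all_analysis.
From mathcomp Require Import zify ring lra.

Set Implicit Arguments.
Unset Strict Implicit.
Unset Printing Implicit Defensive.

Import Order.TTheory GRing.Theory Num.Theory.
Import numFieldNormedType.Exports.

Local Open Scope classical_set_scope.
Local Open Scope ring_scope.

(** The pair is diagonal up to the shift, so [ln] of the norm of L_{xn} ... L_{x1}
    is the supremum over [k] of the sums of the log-weights read along the word at
    positions [k, k + 1, ...].  The log-weights of L_1 are increments of a function
    on the integers made of arbitrarily long runs of sawtooth waves, each tooth of
    depth about [q] falling with slope about [-1] during [q] steps and rising with
    slope [1/q] until step [q^2]; every [q = 2^p] occurs in arbitrarily long runs.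
    A window of length [n] can gain at most [Q + n/Q] for every [Q], so the joint
    spectral radius is [1].  The log-weights of L_0 are at most [-1/2], but agree
    with those of L_1 on the falling parts.  Hence the periodic sequences which are
    0 exactly on the falling parts of the [q]-wave have zero growth rate, while
    0^oo has growth rate at most [-1/2].  Any mixture [mu] of the periodic
    measures with all weights positive is therefore maximising, and its support
    contains 0^oo, so that mixing in the Dirac mass at 0^oo changes neither
    invariance nor the support but destroys maximality.  (There is no contradiction
    with semicontinuity: the [q]-th periodic measure gives 0 the frequency [1/q].) *)

(** * Scales constant on dyadic blocks *)

(** For j > 0, the value on the block [2^j, 2^(j+1)) is the largest power of 2 dividing j. Hence
    every power of 2 is the scale of infinitely many, ever longer blocks. *)
Definition scale (n : nat) : nat := (2 ^ logn 2 (trunc_log 2 n))%N.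

Lemma scale_gt0 n : (0 < scale n)%N.
Proof. by rewrite expn_gt0. Qed.

(** If the 2-adic valuation v of [j] is at least 1, then 2v <= 2^v <= j. So both ends of a dyadic
    block are multiples of its squared scale, and the block consists of whole teeth. *)
Lemma sqr_scale_dvd_pow j : ((2 ^ logn 2 j) ^ 2 %| 2 ^ j)%N.
Proof.
rewrite -expnM; apply: dvdn_exp2l.
have [->|j0] := posnP j; first by rewrite logn0.
have := dvdn_leq j0 (pfactor_dvdnn 2 j).
case: (logn 2 j) => [|v]; first by rewrite mul0n.
apply: leq_trans; rewrite expnSr leq_mul2r /=.
by rewrite ltn_expl.
Qed.

(** A change can only happen at a power of 2; there a tooth of the old wave is complete and a tooth
    of the new one begins. *)
Lemma scale_change n : scale n.+1 != scale n ->
  (scale n ^ 2 %| n.+1)%N && (scale n.+1 ^ 2 %| n.+1)%N.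
Proof.
have [->|n0] := posnP n; first by rewrite /scale !trunc_log1 trunc_log0 eqxx.
set j := trunc_log 2 n; have /andP[jn nj] := trunc_log_bounds (isT : (1 < 2)%N) n0.
have [nj'|nj'] := ltnP n.+1 (2 ^ j.+1)%N.
  have -> : scale n.+1 = scale n.
    by rewrite /scale (@trunc_log_eq 2 j) // nj' (leq_trans jn).
  by rewrite eqxx.
have E : n.+1 = (2 ^ j.+1)%N by apply/eqP; rewrite eqn_leq nj nj'.
move=> _; rewrite {2}/scale E trunc_expnK // sqr_scale_dvd_pow andbT.
apply: dvdn_trans (sqr_scale_dvd_pow j) _.
exact: dvdn_exp2l.
Qed.

Lemma scale_window p N : exists s : nat,
  ((2 ^ p) ^ 2 %| s)%N /\ forall n, (n < N)%N -> scale (s + n) = (2 ^ p)%N.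
Proof.
(* The odd factor keeps the valuation of [j] equal to [p] and makes the block starting at 2^j longer
   than [N]. *)
pose j := (2 ^ p * (2 * N).+1)%N.
have jp : logn 2 j = p.
  by rewrite lognM ?expn_gt0 // pfactorK // logn_coprime ?addn0 //
     coprime2n /= mul2n odd_double.
exists (2 ^ j)%N; split; first by rewrite -{1}jp sqr_scale_dvd_pow.
move=> n nN; rewrite /scale (@trunc_log_eq 2 j) ?jp // leq_addr /=.
rewrite expnS mul2n -addnn ltn_add2l (ltn_trans nN) //.
have : (j < 2 ^ j)%N by apply: ltn_expl.
apply: leq_ltn_trans; rewrite /j; have : (0 < 2 ^ p)%N by rewrite expn_gt0.
by nia.
Qed.

(** * The sawtooth and its increments *)

(** Counting from 0 amounts to counting from the start of the block, which is a multiple of the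
    squared scale. *)
Definition phase (n : nat) : nat := (n %% scale n ^ 2)%N.

Section Weights.
Context {R : realType}.

Definition incr (n : nat) : R := (scale n)%:R^-1 - (phase n < scale n)%N%:R.

Definition sawtooth (n : nat) : R :=
  (phase n)%:R / (scale n)%:R - (minn (phase n) (scale n))%:R.

Lemma sawtooth_incr n :
  sawtooth n + incr n
  = (phase n).+1%:R / (scale n)%:R - (minn (phase n).+1 (scale n))%:R.
Proof.
have -> : minn (phase n).+1 (scale n)
    = (minn (phase n) (scale n) + (phase n < scale n))%N.
  by case: ltnP; lia.
by rewrite natrD -natr1 /sawtooth /incr; ring.
Qed.

Lemma sawtooth_dvd n : (scale n ^ 2 %| n)%N -> sawtooth n = 0.
Proof. by rewrite /sawtooth /phase /dvdn => /eqP ->; rewrite mul0r min0n subr0. Qed.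

(** Over a period of q^2 steps the climb q^2 / q makes up for the fall q. *)
Lemma sawtooth_period n : (scale n ^ 2 %| n.+1)%N -> sawtooth n + incr n = 0.
Proof.
move=> d; rewrite sawtooth_incr.
have -> : (phase n).+1 = (scale n ^ 2)%N.
  have := ltn_pmod n (_ : 0 < scale n ^ 2)%N.
  rewrite expn_gt0 scale_gt0 => /(_ isT) h; apply/eqP; rewrite eqn_leq h /=.
  by rewrite dvdn_leq // /phase -[X in (_ %| X)%N]addn1 /dvdn modnDml addn1.
have q0 := scale_gt0 n.
rewrite -mulnn (minn_idPr _) ?leq_pmulr // natrM mulfK ?subrr //.
by rewrite pnatr_eq0 -lt0n.
Qed.

Lemma sawtoothS n : sawtooth n.+1 = sawtooth n + incr n.
Proof.
have [E|/scale_change/andP[d d']] := eqVneq (scale n.+1) (scale n); last first.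
  by rewrite sawtooth_dvd // sawtooth_period.
have [d|nd] := boolP (scale n ^ 2 %| n.+1)%N.
  by rewrite sawtooth_dvd ?E // sawtooth_period.
rewrite sawtooth_incr /sawtooth /phase E modnS.
by rewrite (negbTE nd).
Qed.

Lemma sawtooth_change n : scale n.+1 != scale n -> sawtooth n.+1 = 0.
Proof. by move=> /scale_change/andP[_ ?]; rewrite sawtooth_dvd. Qed.

Lemma sawtooth_le0 n : sawtooth n <= 0.
Proof.
have q0 := scale_gt0 n; have q0R : 0 < (scale n)%:R :> R by rewrite ltr0n.
rewrite /sawtooth subr_le0 ler_pdivrMr // -natrM ler_nat.
have := ltn_pmod n (_ : 0 < scale n ^ 2)%N; rewrite expn_gt0 q0 => /(_ isT).
by rewrite -/(phase n); nia.
Qed.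

Lemma sawtooth_ge n : - (scale n)%:R <= sawtooth n.
Proof.
rewrite /sawtooth -[leLHS]add0r lerB ?divr_ge0 ?ler0n // ler_nat.
exact: geq_minr.
Qed.

(** * Log-weights of the two operators *)

(** The zero weights on the negative axis give powers of L_1 norm at least 1, which bounds the joint
    spectral radius from below. *)
Definition hi_weight (k : int) : R := if k is Posz n then incr n else 0.

(** The cap at -1/2 changes nothing on falling parts of scale q >= 2, where the increment 1/q - 1 is
    already at most -1/2. *)
Definition weight (x : bool) (k : int) : R :=
  if x then hi_weight k else Num.min (hi_weight k) (- 2^-1).

Lemma incr_le n : incr n <= (scale n)%:R^-1.
Proof. by rewrite /incr gerBl ler0n. Qed.

Lemma invn_le1 (n : nat) : (0 < n)%N -> n%:R^-1 <= 1 :> R.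
Proof. by move=> n0; rewrite invf_le1 ?ler1n // ltr0n. Qed.

Lemma hi_weight_bound k : -1 <= hi_weight k <= 1.
Proof.
case: k => n /=; last by lra.
have q0 := scale_gt0 n.
have q0R : 0 < (scale n)%:R^-1 :> R by rewrite invr_gt0 ltr0n.
have := invn_le1 q0.
by rewrite /incr; case: (_ < _)%N => /= h; rewrite ?mulr1n ?mulr0n; lra.
Qed.

Lemma weight_ge x k : -1 <= weight x k.
Proof.
have /andP[h _] := hi_weight_bound k.
by case: x => //=; rewrite le_min h /=; lra.
Qed.

Lemma weight_le_hi x k : weight x k <= hi_weight k.
Proof. by case: x => //=; rewrite ge_min lexx. Qed.

Lemma weight_le1 x k : weight x k <= 1.
Proof. by have /andP[_] := hi_weight_bound k; apply: le_trans (weight_le_hi x k). Qed.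

Lemma weight0_le k : weight false k <= - 2^-1.
Proof. by rewrite /weight ge_min lexx orbT. Qed.

(* The sawtooth with its teeth deeper than [Q] removed: these rise with slope
   less than [Q^-1]. *)
Definition trunc_sawtooth (Q : nat) (k : int) : R :=
  if k is Posz n then if (scale n <= Q)%N then sawtooth n else 0 else 0.

Lemma trunc_sawtooth_le0 Q k : trunc_sawtooth Q k <= 0.
Proof. by case: k => n //=; case: ifP => // _; exact: sawtooth_le0. Qed.

Lemma trunc_sawtooth_ge Q k : - Q%:R <= trunc_sawtooth Q k.
Proof.
case: k => n /=; last by rewrite oppr_le0.
case: ifP => [h|_]; last by rewrite oppr_le0.
by apply: le_trans (sawtooth_ge n); rewrite lerN2 ler_nat.
Qed.

Lemma NegzS1 n : Negz n.+1 + 1 = Negz n.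
Proof. by rewrite !NegzE; lia. Qed.

(** In teeth of scale at most [Q] the weight is exactly the increment of the truncated potential. In
    deeper teeth the potential is 0 and the weight is at most 1/q < 1/Q. At a change of scale the
    sawtooth returns to 0, so truncation creates no jump. *)
Lemma hi_weight_step Q k : (0 < Q)%N ->
  hi_weight k <= trunc_sawtooth Q (k + 1) - trunc_sawtooth Q k + Q%:R^-1.
Proof.
move=> Q0; have Q0R : 0 < Q%:R^-1 :> R by rewrite invr_gt0 ltr0n.
case: k => [n|[|n]]; last 2 first.
- have -> : Negz 0 + 1 = 0 by [].
  rewrite /= sawtooth_dvd ?dvdn0 //.
  by case: ifP => _; rewrite subrr add0r ltW.
- by rewrite NegzS1 /= subrr add0r ltW.
have -> : Posz n + 1 = n.+1 by rewrite -addn1 PoszD.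
rewrite /=; have [E|ne] := eqVneq (scale n.+1) (scale n).
  rewrite E sawtoothS; case: leqP => [_|Qn]; first by lra.
  rewrite subrr add0r (le_trans (incr_le n)) // lef_pV2 ?qualifE/= ?ltr0n //.
    by rewrite ler_nat ltnW.
  by rewrite scale_gt0.
rewrite sawtooth_change // if_same.
have sE : sawtooth n + incr n = 0 by rewrite -sawtoothS sawtooth_change.
case: leqP => [_|Qn]; first by lra.
rewrite subrr add0r (le_trans (incr_le n)) // lef_pV2 ?qualifE/= ?ltr0n //.
  by rewrite ler_nat ltnW.
by rewrite scale_gt0.
Qed.

(** * Growth along finite words *)

Fixpoint log_weight (w : seq bool) (k : int) : R :=
  if w is x :: w' then weight x k + log_weight w' (k + 1) else 0.

Lemma addr1_size (k : int) (n : nat) : k + 1 + n%:Z = k + n.+1%:Z.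
Proof. by lia. Qed.

Lemma log_weight_le_pot (f : int -> R) (d : R) w k :
  (forall x i, weight x i <= f (i + 1) - f i + d) ->
  log_weight w k <= f (k + (size w)%:Z) - f k + (size w)%:R * d.
Proof.
move=> h; elim: w k => [|x w IH] k /=; first by rewrite addr0 subrr mul0r addr0.
have := IH (k + 1); have := h x k.
rewrite addr1_size -[(size w).+1]addn1 natrD mulrDl mul1r.
by lra.
Qed.

Lemma log_weight_ge_pot (f : int -> R) w k :
  (forall j, (j < size w)%N ->
     f (k + j%:Z + 1) - f (k + j%:Z) <= weight (nth false w j) (k + j%:Z)) ->
  f (k + (size w)%:Z) - f k <= log_weight w k.
Proof.
elim: w k => [|x w IH] k h /=; first by rewrite addr0 subrr.
have := h 0%N isT; rewrite /= addr0 => h0.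
have := IH (k + 1); rewrite addr1_size => {}IH.
have : f (k + (size w).+1%:Z) - f (k + 1) <= log_weight w (k + 1).
  by apply: IH => j jw; have := h j.+1 jw; rewrite /= !addr1_size.
by lra.
Qed.

(** The truncated potential lies between -Q and 0, so the telescoped part contributes at most [Q],
    and each letter loses at most 1/Q. *)
Lemma log_weight_le Q w k : (0 < Q)%N ->
  log_weight w k <= Q%:R + (size w)%:R / Q%:R.
Proof.
move=> Q0; have := @log_weight_le_pot (trunc_sawtooth Q) Q%:R^-1 w k.
have := trunc_sawtooth_le0 Q (k + size w); have := trunc_sawtooth_ge Q k.
move=> h1 h2 /(_ _)/(le_trans) -> //; last by lra.
by move=> x i; apply: le_trans (weight_le_hi x i) (hi_weight_step i Q0).
Qed.

Lemma log_weight_ge w k : - (size w)%:R <= log_weight w k.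
Proof.
elim: w k => [|x w IH] k /=; first by rewrite oppr0.
rewrite -[(size w).+1]addn1 natrD.
by have := IH (k + 1); have := weight_ge x k; lra.
Qed.

Lemma log_weight_zeros n k : log_weight (nseq n false) k <= - (n%:R / 2).
Proof.
elim: n k => [|n IH] k; first by rewrite mul0r oppr0.
rewrite [nseq _ _]/= [log_weight _ _]/= -[n.+1]addn1 natrD.
by have := IH (k + 1); have := weight0_le k; rewrite /weight; lra.
Qed.

Lemma log_weight_ones n : log_weight (nseq n true) (- n%:Z) = 0.
Proof.
elim: n => [//|n IH]; rewrite /= -NegzE /= add0r.
have -> : Negz n + 1 = - n%:Z by rewrite NegzE; lia.
exact: IH.
Qed.

End Weights.

(** With q = 2^p, this is the [i]-th shift of the sequence of period q^2 whose symbol is 0 on the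
    first q places of each period, that is, on the falling part of a tooth. *)
Definition orbit_point (p i : nat) : Sigma2 :=
  fun k : int => ((2 ^ p)%:Z <= ((k + i%:Z) %% ((2 ^ p) ^ 2)%N%:Z)%Z).

(** Read in phase inside a long stretch of scale q = 2^p, the word meets exactly the sawtooth
    increments, so its sum is a difference of two sawtooth values in [-q, 0]. *)
Lemma log_weight_orbit {R : realType} p i n : (0 < p)%N ->
  exists k, - (2 ^ p)%:R <= log_weight (word (orbit_point p i) n) k :> R.
Proof.
move=> p0; have [s [sd sE]] := scale_window p (i.+1 + n).+1.
(* Words start at coordinate 1, hence [i.+1] and not [i]. *)
exists (s + i.+1)%N%:Z; set w := word _ _.
have sw : size w = n by rewrite size_map size_iota.
pose f (k : int) : R := if k is Posz m then sawtooth m else 0.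
have := @log_weight_ge_pot R f w (s + i.+1)%N%:Z.
rewrite sw => h; apply: (le_trans _ (h _)).
  rewrite /f -PoszD -addnA.
  have := @sawtooth_ge R (s + (i.+1 + n)); rewrite sE //.
  by have := @sawtooth_le0 R (s + i.+1); lra.
move=> j jn; rewrite -PoszD -addnA; set m := (s + _)%N.
have mE : scale m = (2 ^ p)%N by apply: sE; lia.
have -> : Posz m + 1 = m.+1 by rewrite -addn1 PoszD.
rewrite /f sawtoothS addrAC subrr add0r.
rewrite (nth_map 0%N) ?size_iota // nth_iota // /orbit_point.
have -> : (((1 + j)%N%:Z + i%:Z) %% ((2 ^ p) ^ 2)%N%:Z)%Z = phase m :> int.
  rewrite -PoszD modz_nat /phase mE; congr Posz.
  by rewrite /m; case/dvdnP: sd => t ->; rewrite modnMDl; congr (_ %% _)%N; lia.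
(* Symbol 1 is immediate. For symbol 0 the phase is below q, and q >= 2 makes the minimum equal to
   the increment. *)
rewrite lez_nat -mE; case: leqP => //= h1.
rewrite le_min lexx /= /incr h1 mulr1n mE.
have : (2 ^ p)%:R^-1 <= 2^-1 :> R.
  rewrite lef_pV2 ?qualifE/= ?ltr0n ?expn_gt0 // ler_nat.
  by rewrite -{1}(expn1 2) leq_exp2l.
by lra.
Qed.

(** * Bounded operators between orthonormal sequences *)

Section Hilbert.
Context {R : realType} {H : completeNormedModType R} {ip : {dot H for idfun}}.
Hypothesis hip : inner_product_norm ip.

Lemma ip_sym x y : ip x y = ip y x.
Proof. by rewrite hermC expr0 mul1r. Qed.

Section OrthonormalSequence.
Variable u : nat -> H.
Hypothesis ou : forall i j, ip (u i) (u j) = (i == j)%:R.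

Lemma ip_sum_orthonormal x (c : nat -> R) m n :
  ip x (\sum_(m <= i < n) c i *: u i) = \sum_(m <= i < n) c i * ip x (u i).
Proof. by rewrite linear_sumr; apply: eq_bigr => i _; rewrite linearZr_LR. Qed.

Lemma ip_sum_basis (c : nat -> R) m n j : (m <= j < n)%N ->
  ip (\sum_(m <= i < n) c i *: u i) (u j) = c j.
Proof.
move=> mjn; rewrite ip_sym ip_sum_orthonormal.
rewrite (bigD1_seq j) ?mem_index_iota ?iota_uniq //= ou eqxx mulr1.
by rewrite big1 ?addr0 // => i /negbTE ij; rewrite ou eq_sym ij mulr0.
Qed.

Lemma sqr_norm_sum (c : nat -> R) m n :
  `|\sum_(m <= i < n) c i *: u i| ^+ 2 = \sum_(m <= i < n) c i ^+ 2.
Proof.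
rewrite hip ip_sum_orthonormal; apply: eq_big_nat => j mjn.
by rewrite ip_sum_basis // expr2.
Qed.

Lemma bessel x n : \sum_(0 <= i < n) ip x (u i) ^+ 2 <= `|x| ^+ 2.
Proof.
pose S := \sum_(0 <= i < n) ip x (u i) *: u i.
have xS : ip x S = \sum_(0 <= i < n) ip x (u i) ^+ 2.
  by rewrite ip_sum_orthonormal; apply: eq_bigr => i _; rewrite expr2.
have := sqr_ge0 `|x - S|; rewrite hip.
have -> : ip (x - S) (x - S) = ip x x - ip S x - (ip x S - ip S S).
  by rewrite linearBr !linearBl.
by rewrite -!hip sqr_norm_sum // (ip_sym S x) xS; lra.
Qed.

End OrthonormalSequence.

(** T x is the sum of the a_i <x, u_i> v_i. By orthonormality and Bessel's inequality for [u] the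
    series is Cauchy, and the bound on partial sums passes to the limit. *)
Lemma orthonormal_operator (u v : nat -> H) (a : nat -> R) (M : R) :
  (forall i j, ip (u i) (u j) = (i == j)%:R) ->
  (forall i j, ip (v i) (v j) = (i == j)%:R) ->
  (forall i, `|a i| <= M) ->
  exists T : {linear H -> H}, (forall x, `|T x| <= M * `|x|) /\
    forall i, T (u i) = a i *: v i.
Proof.
move=> ou ov aM.
have M0 : 0 <= M by apply: le_trans (aM 0%N).
pose s x := series (fun i => (a i * ip x (u i)) *: v i).
have sE x m n : `|\sum_(m <= i < n) (a i * ip x (u i)) *: v i| ^+ 2
    <= M ^+ 2 * \sum_(m <= i < n) ip x (u i) ^+ 2.
  rewrite (sqr_norm_sum ov) mulr_sumr; apply: ler_sum => i _.
  rewrite exprMn ler_wpM2r ?sqr_ge0 // -real_normK ?num_real //.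
  by rewrite lerXn2r ?nnegrE.
have cs x : cvgn (s x).
  have cb : cvgn (series (fun i => ip x (u i) ^+ 2)).
    apply: nondecreasing_is_cvgn.
      by apply: nondecreasing_series => i _ _; exact: sqr_ge0.
    by exists (`|x| ^+ 2) => _ [n _ <-]; exact: bessel.
  apply: cauchy_cvg; apply/cauchy_seriesP => e e0.
  (* [M + 1] stands in for [M] to keep the divisor positive. *)
  have e' : 0 < e ^+ 2 / (M + 1) ^+ 2 by rewrite divr_gt0 ?exprn_gt0 // ltr_wpDl.
  move/cvg_cauchy/cauchy_seriesP: cb => /(_ _ e').
  apply: filterS => -[m n] /= h.
  rewrite -(@ltr_pXn2r _ 2) ?nnegrE ?(ltW e0) //.
  apply: le_lt_trans (sE _ _ _) _.
  rewrite ltr_pdivlMr ?exprn_gt0 ?ltr_wpDl // in h.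
  apply: le_lt_trans h; rewrite mulrC ler_pM ?sqr_ge0 ?ler_norm ?sumr_ge0 //.
    by move=> i _; exact: sqr_ge0.
  by rewrite lerXn2r ?nnegrE ?addr_ge0 // lerDl.
pose T x := limn (s x).
have sT x : s x @ \oo --> T x by exact: cs.
have linT : linear T.
  move=> k x y; apply: cvg_lim => //.
  have -> : s (k *: x + y) = (fun n => k *: s x n + s y n).
    apply/funext => n; rewrite /s /series /= scaler_sumr -big_split /=.
    apply: eq_bigr => i _; rewrite linearPl scalerA -scalerDl.
    by congr (_ *: _); rewrite /=; ring.
  by apply: cvgD (sT y); apply: cvgZr (sT x).
pose TL : {linear H -> H} := HB.pack T (GRing.isLinear.Build _ _ _ _ T linT).
exists TL; split => [x|i] /=.
  have nT : `|s x n| @[n --> \oo] --> `|T x| by apply: cvg_norm; exact: sT.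
  apply: (cvgr_to_le nT); apply: nearW => n.
  rewrite -(@ler_pXn2r _ 2) ?nnegrE ?mulr_ge0 // exprMn.
  apply: le_trans (sE _ _ _) _.
  by rewrite ler_wpM2l ?sqr_ge0 //; exact: bessel.
apply: cvg_lim => //.
apply: cvg_near_cst; exists i.+1 => // n /= ni.
rewrite /s /series /= (bigD1_seq i) ?mem_index_iota ?iota_uniq //=.
rewrite ou eqxx mulr1 big1 ?addr0 // => j /negbTE ji.
by rewrite ou eq_sym ji mulr0 scale0r.
Qed.

End Hilbert.

(** * Enumeration of the integers and a criterion for convergence to 0 *)

Definition int_of_code (n : nat) : int := if odd n then Negz n./2 else n./2.

Definition code_of_int (k : int) : nat :=
  match k with Posz n => n.*2 | Negz n => n.*2.+1 end.

Lemma code_of_intK : cancel code_of_int int_of_code.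
Proof.
by case=> n; rewrite /int_of_code /= odd_double /= ?doubleK // uphalf_double.
Qed.

Lemma int_of_codeK : cancel int_of_code code_of_int.
Proof.
by move=> n; rewrite /int_of_code; case: ifP => o /=; have := odd_double_half n;
  rewrite o.
Qed.

Lemma invn_lt {R : realType} (d : R) : 0 < d ->
  exists2 Q : nat, (0 < Q)%N & Q%:R^-1 < d.
Proof.
move=> d0; have [Q hQ] : exists Q : nat, d^-1 < Q%:R.
  by exists (Num.truncn d^-1).+1; rewrite truncnS_gt.
have Q0 : 0 < Q%:R :> R by apply: lt_trans hQ; rewrite invr_gt0.
by exists Q; [rewrite -(ltr0n R)|rewrite invf_plt ?posrE].
Qed.

(** [Q] is chosen first, then [n] large in terms of the constant. Both the spectral radius and the
    integrals against the mixture are estimated in this form. *)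
Lemma cvg0_sublinear {R : realType} (u : nat -> R) :
  (forall Q : nat, (0 < Q)%N -> exists C : R,
     forall n : nat, (0 < n)%N -> `|u n| <= C / n%:R + Q%:R^-1) ->
  u n @[n --> \oo] --> 0.
Proof.
move=> hu; apply/cvgr0Pnorm_lt => d d0.
have d2 : 0 < d / 2 by rewrite divr_gt0.
have [Q Q0 Qd] := invn_lt d2; have [C hC] := hu Q Q0.
pose C' := `|C| + 1; have C'0 : 0 < C' by rewrite ltr_wpDl.
have [N N0 Nd] := invn_lt (divr_gt0 d2 C'0).
exists N => // n /= Nn; have n0 : (0 < n)%N by apply: leq_trans Nn.
apply: le_lt_trans (hC n n0) _.
have n0R : 0 < n%:R :> R by rewrite ltr0n.
have N0R : 0 < N%:R :> R by rewrite ltr0n.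
have : C / n%:R <= C' / N%:R.
  apply: (@le_trans _ _ (C' / n%:R)).
    by rewrite ler_wpM2r ?invr_ge0 ?ler0n // /C' ler_wpDr // ler_norm.
  by rewrite ler_wpM2l ?(ltW C'0) // lef_pV2 ?posrE // ler_nat.
move: Nd; rewrite ltr_pdivlMr // mulrC => h1 h2.
by rewrite [ltRHS]splitr; apply: ltrD => //; apply: le_lt_trans h2 h1.
Qed.

(** * Weighted shifts *)

Section ShiftOperators.
Context {R : realType} {H : completeNormedModType R} {ip : {dot H for idfun}}.
Variable e : int -> H.
Hypotheses (hip : inner_product_norm ip) (he : orthonormal_basis ip e).

Lemma norm_basis k : `|e k| = 1.
Proof.
apply/eqP; rewrite -(@pexpr_eq1 _ _ 2) // hip.
by have [-> _] := he; rewrite eqxx.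
Qed.

Lemma shift_operator (s : int) (a : int -> R) (M : R) :
  (forall k, `|a k| <= M) ->
  exists T : {linear H -> H}, (forall x, `|T x| <= M * `|x|) /\
    forall k, T (e k) = a k *: e (k + s).
Proof.
move=> aM; have [oe _] := he.
have inj := can_inj int_of_codeK.
have [|||T [TM Te]] := @orthonormal_operator R H ip hip
  (e \o int_of_code) (fun i => e (int_of_code i + s)) (a \o int_of_code) M.
- by move=> i j; rewrite oe (inj_eq inj).
- by move=> i j; rewrite oe (inj_eq (addIr s)) (inj_eq inj).
- by move=> i; exact: aM.
by exists T; split=> // k; have := Te (code_of_int k); rewrite /= code_of_intK.
Qed.

Lemma bounded_op_comp (A B : H -> H) :
  bounded_op A -> bounded_op B -> bounded_op (B \o A).
Proof.
move=> [a hA] [b hB]; exists (`|b| * `|a|) => x /=.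
apply: le_trans (hB _) _; apply: (@le_trans _ _ (`|b| * `|A x|)).
  by rewrite ler_wpM2r // ler_norm.
rewrite -mulrA ler_wpM2l // (le_trans (hA _)) //.
by rewrite ler_wpM2r // ler_norm.
Qed.

(** The operators agree on the dense span of the basis; a point y of the span within |A x - B x| / M
    of x would give |A x - B x| < |A x - B x|. *)
Lemma eq_on_basis (A B : {linear H -> H}) :
  bounded_op A -> bounded_op B -> (forall k, A (e k) = B (e k)) -> A =1 B.
Proof.
move=> [a hA] [b hB] AB x; apply/eqP; rewrite -subr_eq0 -normr_eq0.
apply: contraT => nz; have D0 : 0 < `|A x - B x| by rewrite lt0r nz /=.
pose M := `|a| + `|b| + 1; have M0 : 0 < M by rewrite ltr_wpDl ?addr_ge0.
have [_ /(_ (ball x (`|A x - B x| / M)))] := he.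
case; [by exists x; apply: ballxx; rewrite divr_gt0|exact: ball_open|].
move=> y [xy [s [c yE]]].
have ABy : A y = B y.
  by rewrite yE !linear_sum; apply: eq_bigr => i _; rewrite !linearZ /= AB.
move: xy; rewrite -ball_normE /= ltr_pdivlMr // => /lt_geF; apply: contraFT => _.
have -> : A x - B x = A (x - y) - B (x - y).
  by rewrite (linearB A) (linearB B) ABy opprB addrA subrK.
apply: le_trans (ler_normB _ _) _; rewrite mulrC /M !mulrDl mul1r.
rewrite ler_wpDr // lerD //.
  by apply: le_trans (hA _) _; rewrite ler_wpM2r // ler_norm.
by apply: le_trans (hB _) _; rewrite ler_wpM2r // ler_norm.
Qed.

(** The inverse is the backward shift with reciprocal coefficients, which obey the same bound. *)
Lemma weighted_shift_exists (a : int -> R) :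
  (forall k, expR (-1) <= a k <= expR 1) ->
  exists L : {linear H -> H}, bounded_op L /\
    invertible_op L /\ forall k, L (e k) = a k *: e (k + 1).
Proof.
move=> ab.
have a0 k : 0 < a k.
  by have /andP[h _] := ab k; apply: lt_le_trans h; exact: expR_gt0.
have [|L [LM Le]] := @shift_operator 1 a (expR 1).
  by move=> k; rewrite gtr0_norm //; have /andP[] := ab k.
have [|L' [L'M L'e]] := @shift_operator (-1) (fun k => (a (k - 1))^-1) (expR 1).
  move=> k; rewrite gtr0_norm ?invr_gt0 //.
  have /andP[h _] := ab (k - 1).
  by rewrite -[leRHS]invrK -expRN lef_pV2 ?posrE ?expR_gt0.
have bL : bounded_op L by exists (expR 1).
have bL' : bounded_op L' by exists (expR 1).
have bid : bounded_op (idfun : H -> H) by exists 1 => x; rewrite mul1r.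
exists L; do 2!split => //; exists L'; split => //.
  move=> x; apply: (@eq_on_basis (L' \o L) idfun) => [||k] //=.
    exact: bounded_op_comp.
  by rewrite Le linearZ /= L'e addrK scalerA divff ?scale1r // gt_eqF.
move=> x; apply: (@eq_on_basis (L \o L') idfun) => [||k] //=.
  exact: bounded_op_comp.
by rewrite L'e linearZ /= Le subrK scalerA mulVf ?scale1r // gt_eqF.
Qed.

(** * Norms of products and the joint spectral radius *)

Section Words.
Variable L : {linear H -> H} * {linear H -> H}.
Hypotheses (bL1 : bounded_op L.1) (bL2 : bounded_op L.2).
Hypothesis L1e : forall k, L.1 (e k) = expR (weight false k) *: e (k + 1).
Hypothesis L2e : forall k, L.2 (e k) = expR (weight true k) *: e (k + 1).

(** [word_op] is a bare function; a linear representative allows comparison on the basis. *)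
Lemma word_op_linear w :
  exists2 A : {linear H -> H}, bounded_op A & word_op L w =1 A.
Proof.
elim: w => [|b w [A bA AE]].
  by exists idfun => //; exists 1 => x; rewrite mul1r.
case: b.
  by exists (A \o L.2) => [|x]; [exact: bounded_op_comp|exact: AE].
by exists (A \o L.1) => [|x]; [exact: bounded_op_comp|exact: AE].
Qed.

Lemma word_op_basis w k :
  word_op L w (e k) = expR (log_weight w k) *: e (k + (size w)%:Z).
Proof.
elim: w k => [|b w IH] k; first by rewrite /= expR0 scale1r addr0.
have [A _ AE] := word_op_linear w.
have -> : word_op L (b :: w) (e k) = A (if b then L.2 (e k) else L.1 (e k)).
  by rewrite -AE.
have -> : (if b then L.2 (e k) else L.1 (e k)) = expR (weight b k) *: e (k + 1).
  by case: b.
by rewrite linearZ /= -AE IH scalerA -expRD addr1_size.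
Qed.

(** On the basis the product agrees with a single weighted shift by the length of the word, whose
    norm is controlled by its coefficients. *)
Lemma word_op_le w (c : R) (x : H) : (forall k, log_weight w k <= c) ->
  `|word_op L w x| <= expR c * `|x|.
Proof.
move=> wc; have [A bA AE] := word_op_linear w; rewrite AE.
have [|T [TM Te]] :=
  @shift_operator (size w)%:Z (fun k => expR (log_weight w k)) (expR c).
  by move=> k; rewrite gtr0_norm ?expR_gt0 // ler_expR.
rewrite (@eq_on_basis A T) => // [|k]; first by exists (expR c).
by rewrite Te -AE word_op_basis.
Qed.

Lemma opnorm_word_op_le w (c : R) : (forall k, log_weight w k <= c) ->
  opnorm (word_op L w) <= expR c.
Proof.
move=> wc; apply: ge_sup.
  by exists `|word_op L w 0|; exists 0 => //=; rewrite normr0 ler01.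
move=> _ [x /= x1 <-]; apply: le_trans (word_op_le x wc) _.
by rewrite ler_piMr ?expR_ge0.
Qed.

Lemma opnorm_word_op_ge w k : expR (log_weight w k) <= opnorm (word_op L w).
Proof.
apply: ub_le_sup; last first.
  exists (e k) => /=; first by rewrite norm_basis.
  by rewrite word_op_basis normrZ norm_basis mulr1 gtr0_norm ?expR_gt0.
(* The supremum needs some upper bound: the growth estimate with Q = 1. *)
exists (expR (1 + (size w)%:R / 1)) => _ [x /= x1 <-].
apply: le_trans (@word_op_le w _ x (fun k => log_weight_le w k (ltn0Sn 0))) _.
by rewrite ler_piMr ?expR_ge0.
Qed.

Lemma opnorm_word_op_gt0 w : 0 < opnorm (word_op L w).
Proof. by apply: lt_le_trans (opnorm_word_op_ge w 0); exact: expR_gt0. Qed.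

Lemma ln_opnorm_le w (c : R) : (forall k, log_weight w k <= c) ->
  ln (opnorm (word_op L w)) <= c.
Proof.
move=> wc; rewrite -[leRHS]expRK ler_ln ?posrE ?expR_gt0 ?opnorm_word_op_gt0 //.
exact: opnorm_word_op_le.
Qed.

Lemma ln_opnorm_ge w k : log_weight w k <= ln (opnorm (word_op L w)).
Proof.
rewrite -[leLHS]expRK ler_ln ?posrE ?expR_gt0 ?opnorm_word_op_gt0 //.
exact: opnorm_word_op_ge.
Qed.

(** The upper bound exp(Q/n + 1/Q) holds for every Q; the lower bound 1 comes from words of ones
    read from -n up to 0. *)
Lemma ln_joint_spectral_radius : ln (joint_spectral_radius L) = 0.
Proof.
suff -> : joint_spectral_radius L = 1 by rewrite ln1.
pose E n := [set opnorm (word_op L w) `^ n%:R^-1 | w in [set: n.-tuple bool]].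
have ub n Q : (0 < Q)%N -> (0 < n)%N ->
    ubound (E n) (expR (Q%:R / n%:R + Q%:R^-1)).
  move=> Q0 n0 _ [w _ <-]; have n0R : 0 < n%:R :> R by rewrite ltr0n.
  rewrite /powR gt_eqF ?opnorm_word_op_gt0 // ler_expR mulrC ler_pdivrMr //.
  rewrite mulrDl divfK ?gt_eqF // mulrC; apply: ln_opnorm_le => k.
  by have := @log_weight_le R Q w k Q0; rewrite size_tuple.
have lb n : (0 < n)%N -> 1 <= sup (E n).
  move=> n0; have n0R : 0 < n%:R :> R by rewrite ltr0n.
  apply: (@le_trans _ _ (opnorm (word_op L (nseq_tuple n true)) `^ n%:R^-1)).
    rewrite /powR gt_eqF ?opnorm_word_op_gt0 // -[leLHS]expR0 ler_expR.
    rewrite mulr_ge0 ?invr_ge0 ?(ltW n0R) //.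
    by have := ln_opnorm_ge (nseq n true) (- n%:Z); rewrite log_weight_ones.
  apply: ub_le_sup; last by exists (nseq_tuple n true).
  by exists (expR (1%:R / n%:R + 1%:R^-1)); exact: ub.
have sup0 : ln (sup (E n)) @[n --> \oo] --> (0 : R).
  apply: cvg0_sublinear => Q Q0; exists Q%:R => n n0.
  have s1 := lb n n0; rewrite ger0_norm ?ln_ge0 //.
  rewrite -[leRHS]expRK ler_ln ?posrE ?expR_gt0 ?(lt_le_trans _ s1) //.
  apply: ge_sup (ub n Q Q0 n0).
  exists (opnorm (word_op L (nseq_tuple n true)) `^ n%:R^-1).
  by exists (nseq_tuple n true).
apply: cvg_lim => //; rewrite -[X in _ --> X]expR0.
have : expR (ln (sup (E n))) @[n --> \oo] --> expR 0.
  by apply: continuous_cvg sup0; exact: continuous_expR.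
apply: cvg_trans; apply: near_eq_cvg; exists 1%N => // n /= n0.
by rewrite lnK // posrE (lt_le_trans _ (lb n n0)).
Qed.

End Words.
End ShiftOperators.

(** * Topology of the sequence space *)

Lemma nbhs_coordinate (x : Sigma2) (k : int) :
  \forall y \near x, (y : Sigma2) k = x k.
Proof.
exact: (@proj_continuous int (fun=> bool) k x _ (@discrete_set1 bool (x k))).
Qed.

(** A word depends on finitely many coordinates, so no condition on [P] is called for. *)
Lemma open_word (n : nat) (P : seq bool -> Prop) :
  open [set x : Sigma2 | P (word x n)].
Proof.
rewrite openE => x Px; rewrite /interior.
suff : \forall y \near x, word y n = word x n by apply: filterS => y /= ->.
have : \forall y \near x, forall i : 'I_n, (y : Sigma2) i.+1%:Z = x i.+1%:Z.
  exact: (@filter_forall _ _ (fun (i : 'I_n) (y : Sigma2) => y i.+1%:Z = x i.+1%:Z)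
    _ (nbhs_filter x) (fun i => nbhs_coordinate x i.+1%:Z)).
apply: filterS => y yx; apply: (@eq_from_nth _ false) => [|i].
  by rewrite !size_map.
rewrite size_map size_iota => lin.
by rewrite !(nth_map 0%N) ?size_iota // nth_iota // (yx (Ordinal lin)).
Qed.

Lemma measurable_word (n : nat) (P : seq bool -> Prop) :
  measurable ([set x | P (word x n)] : set borelSigma2).
Proof. by apply: sub_sigma_algebra; exact: open_word. Qed.

Lemma cvg_coordinates (y : nat -> Sigma2) (z : Sigma2) :
  (forall k, \forall n \near \oo, y n k = z k) -> y n @[n --> \oo] --> z.
Proof.
move=> h; apply/cvg_sup => k; apply/cvg_image.
  apply/seteqP; split => // b _; exists (fun=> b) => //.
move=> U /nbhs_singleton Uz.
exists (fun x : Sigma2 => U (x k)); first by apply: filterS (h k) => n /= ->.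
apply/seteqP; split => [_ [x Ux <-]//|b Ub].
by exists (fun=> b).
Qed.

Definition zeros : Sigma2 := fun=> false.

(** Shifting by half the length of a run of 2^(n+1) zeros puts the origin in its middle, so all
    coordinates with |k| < 2^n vanish. *)
Lemma cvg_orbit_zeros : orbit_point n.+1 (2 ^ n) @[n --> \oo] --> zeros.
Proof.
apply: cvg_coordinates => k; exists `|k|%N => // n /= kn.
apply/negbTE; rewrite -ltNge.
have kn2 : (`|k| < 2 ^ n)%N by apply: leq_ltn_trans kn _; rewrite ltn_expl.
have h : (2 ^ n.+1 <= (2 ^ n.+1) ^ 2)%N by rewrite -mulnn leq_pmulr // expn_gt0.
rewrite modz_small; rewrite expnS mul2n -addnn in h *; lia.
Qed.

Lemma word_zeros n : word zeros n = nseq n false.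
Proof.
by rewrite /word -{2}(size_iota 1 n); elim: (iota 1 n) => //= a s ->.
Qed.

(** * Integrals of functions of finite words *)

Section Measures.
Context {R : realType}.

(** The integrand is the comparison function equal to [l] on [A] and to [u] elsewhere. *)
Lemma Rintegral_two_levels (mu : probability borelSigma2 R) (A : set borelSigma2)
    (u l : R) : measurable A ->
  mu.-integrable setT (EFin \o (fun x => u - (u - l) * \1_A x)) /\
  \int[mu]_x (u - (u - l) * \1_A x) = u - (u - l) * fine (mu A).
Proof.
move=> mA.
have iu : mu.-integrable setT (EFin \o cst u).
  exact: finite_measure_integrable_cst.
have i1 : mu.-integrable setT (EFin \o (\1_A : _ -> R)).
  exact: integrable_indic.
have i2 : mu.-integrable setT (EFin \o (fun x => (u - l) * \1_A x)).
  by apply: (@integrableZl _ _ _ mu setT measurableT (u - l) _ i1).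
split; first exact: (integrableB measurableT iu i2).
rewrite RintegralB // Rintegral_cst //.
rewrite [X in u * fine X](_ : _ = 1%E) ?mulr1; last exact: probability_setT.
by rewrite RintegralZl // /Rintegral integral_indic // setIT.
Qed.

Section Bounds.
Variables (mu : probability borelSigma2 R) (n : nat) (f : seq bool -> R) (M : R).
Hypothesis fM : forall x : Sigma2, `|f (word x n)| <= M.

Lemma integrable_word : mu.-integrable setT (EFin \o (fun x => f (word x n))).
Proof.
apply: measurable_bounded_integrable => //.
- by rewrite -ge0_fin_numE // fin_num_measure.
- move=> _ Y _; rewrite setTI.
  exact: (measurable_word n (fun w => Y (f w))).
- exists M; split; rewrite ?num_real // => r Mr x _ /=.
  exact: le_trans (fM x) (ltW Mr).
Qed.

Lemma Rintegral_word_le (P : seq bool -> Prop) (u l : R) :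
  (forall x, f (word x n) <= u) -> (forall x, P (word x n) -> f (word x n) <= l) ->
  \int[mu]_x f (word x n) <=
  u - (u - l) * fine (mu [set x | P (word x n)]).
Proof.
move=> fu fl; have mP := measurable_word n P.
have [i E] := Rintegral_two_levels mu u l mP; rewrite -[leRHS]E.
apply: le_Rintegral => //; first exact: integrable_word.
move=> x _; have [Px|nPx] := pselect (P (word x n)).
  by rewrite indicE mem_set // mulr1 subKr; exact: fl.
by rewrite indicE memNset // mulr0 subr0.
Qed.

Lemma Rintegral_word_ge (P : seq bool -> Prop) (u l : R) :
  (forall x, u <= f (word x n)) -> (forall x, P (word x n) -> l <= f (word x n)) ->
  u - (u - l) * fine (mu [set x | P (word x n)]) <=
  \int[mu]_x f (word x n).
Proof.
move=> fu fl; have mP := measurable_word n P.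
have [i E] := Rintegral_two_levels mu u l mP; rewrite -[leLHS]E.
apply: le_Rintegral => //; first exact: integrable_word.
move=> x _; have [Px|nPx] := pselect (P (word x n)).
  by rewrite indicE mem_set // mulr1 subKr; exact: fl.
by rewrite indicE memNset // mulr0 subr0.
Qed.

End Bounds.
End Measures.

(** * Periodic orbits and their mixtures *)

Lemma sigma_shift_orbit p i : sigma_shift (orbit_point p i) = orbit_point p i.+1.
Proof. by apply/funext => k; rewrite /sigma_shift /orbit_point addr1_size. Qed.

Lemma orbit_point_period p : orbit_point p ((2 ^ p) ^ 2) = orbit_point p 0.
Proof. by apply/funext => k; rewrite /orbit_point modzDr addr0. Qed.

Section Mixtures.
Context {R : realType}.

(** Mass of each of the q^2 shifts, q = 2^(p+1), for a total of 2^-(p+1). Starting at p + 1 makes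
    the totals sum to 1 and keeps q >= 2. *)
Let orbit_mass (p : nat) : R := (2 ^ p.+1)%:R^-1 / ((2 ^ p.+1) ^ 2)%:R.

Let orbit_mass_ge0 p : 0 <= orbit_mass p.
Proof. by rewrite divr_ge0 ?invr_ge0 ?ler0n. Qed.

Definition orbit_measure (p : nat) : {measure set borelSigma2 -> \bar R} :=
  mscale (NngNum (orbit_mass_ge0 p))
    (msum (fun i => \d_(orbit_point p.+1 i : borelSigma2)) ((2 ^ p.+1) ^ 2)).

Lemma orbit_measureE p (A : set borelSigma2) : orbit_measure p A =
  ((orbit_mass p)%:E *
   \sum_(i < (2 ^ p.+1) ^ 2) \d_(orbit_point p.+1 i : borelSigma2) A)%E.
Proof. by []. Qed.

Lemma orbit_measure_full p (A : set borelSigma2) :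
  (forall i, A (orbit_point p.+1 i)) -> orbit_measure p A = (2 ^ p.+1)%:R^-1%:E.
Proof.
move=> hA; rewrite orbit_measureE.
under eq_bigr do rewrite diracE mem_set //.
by rewrite sumEFin -EFinM big_const_ord iter_addr addr0 -mulrA mulVf ?mulr1.
Qed.

Lemma orbit_measure_gt0 p i (A : set borelSigma2) : (i < (2 ^ p.+1) ^ 2)%N ->
  A (orbit_point p.+1 i) -> (0 < orbit_measure p A)%E.
Proof.
move=> ip Ai; rewrite orbit_measureE mule_gt0 //.
  by rewrite lte_fin divr_gt0 ?invr_gt0 ?ltr0n ?expn_gt0.
rewrite (bigD1 (Ordinal ip)) //= diracE mem_set //.
by apply: (lt_le_trans lte01); rewrite leeDl // sume_ge0.
Qed.

(** The shift permutes the orbit cyclically: the last term of one sum is the first of the other. *)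
Lemma orbit_measure_shift p (A : set borelSigma2) :
  orbit_measure p (sigma_shift @^-1` A) = orbit_measure p A.
Proof.
rewrite !orbit_measureE; congr (_ * _)%E.
pose d i : \bar R := \d_(orbit_point p.+1 i : borelSigma2) A.
transitivity (\sum_(i < (2 ^ p.+1) ^ 2) d i.+1)%E.
  by apply: eq_bigr => i _; rewrite /d !diracE -sigma_shift_orbit.
have dP : d ((2 ^ p.+1) ^ 2)%N = d 0%N by rewrite /d orbit_point_period.
have : (0 < (2 ^ p.+1) ^ 2)%N by rewrite !expn_gt0.
move: dP; case: (_ ^ 2)%N => // P dP _.
by rewrite big_ord_recr [RHS]big_ord_recl /= dP addeC.
Qed.

Definition orbit_mixture : set borelSigma2 -> \bar R := mseries orbit_measure 0.

HB.instance Definition _ := Measure.on orbit_mixture.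

Lemma sum_half_pow P :
  \sum_(0 <= p < P) (2 ^ p.+1)%:R^-1 = 1 - (2 ^ P)%:R^-1 :> R.
Proof.
elim: P => [|P IH]; first by rewrite big_nil expn0 invr1 subrr.
rewrite big_nat_recr //= IH expnS natrM invfM; lra.
Qed.

Lemma orbit_mixture_setT : orbit_mixture setT = 1%E.
Proof.
rewrite /orbit_mixture /mseries.
under eq_eseriesr do rewrite orbit_measure_full //.
have := @cvg_geometric_eseries_half R 1 0; rewrite expr0 divr1 => h.
by rewrite -(cvg_lim _ h) //; congr (limn _); apply/funext => n;
  apply: eq_bigr => i _; rewrite mul1r addn1.
Qed.

HB.instance Definition _ :=
  Measure_isProbability.Build _ _ _ orbit_mixture orbit_mixture_setT.

Lemma orbit_mixture_ge P (A : set borelSigma2) :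
  (forall p i, (p < P)%N -> A (orbit_point p.+1 i)) ->
  ((1 - (2 ^ P)%:R^-1)%:E <= orbit_mixture A)%E.
Proof.
move=> hA; apply: (@le_trans _ _ (\sum_(0 <= p < P) orbit_measure p A)%E).
  rewrite -sum_half_pow -sumEFin big_nat_cond [leRHS]big_nat_cond.
  apply: lee_sum => p /andP[/andP[_ pP] _].
  by rewrite orbit_measure_full // => i; exact: hA.
by apply: (@nneseries_lim_ge R (fun p => orbit_measure p A) xpredT 0 P).
Qed.

Lemma orbit_mixture_gt0 p i (A : set borelSigma2) : (i < (2 ^ p.+1) ^ 2)%N ->
  A (orbit_point p.+1 i) -> (0 < orbit_mixture A)%E.
Proof.
move=> ip Ai; apply: (@lt_le_trans _ _ (\sum_(0 <= j < p.+1) orbit_measure j A)%E).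
  rewrite big_nat_recr //=; apply: (lt_le_trans (orbit_measure_gt0 ip Ai)).
  by rewrite leeDr // sume_ge0.
by apply: (@nneseries_lim_ge R (fun p => orbit_measure p A) xpredT 0 p.+1).
Qed.

Lemma orbit_mixture_shift : shift_invariant orbit_mixture.
Proof. by move=> A _; apply: eq_eseriesr => p _; exact: orbit_measure_shift. Qed.

Let half : {nonneg R} := NngNum (ltW (divr_gt0 ltr01 (ltr0n _ 2))).

Definition mixture_with_zeros : set borelSigma2 -> \bar R :=
  measure_add (mscale half orbit_mixture) (mscale half (\d_(zeros : borelSigma2))).

HB.instance Definition _ := Measure.on mixture_with_zeros.

Lemma mixture_with_zerosE A : mixture_with_zeros A =
  ((1 / 2)%:E * orbit_mixture A + (1 / 2)%:E * \d_(zeros : borelSigma2) A)%E.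
Proof. by rewrite /mixture_with_zeros measure_addE. Qed.

Lemma mixture_with_zeros_setT : mixture_with_zeros setT = 1%E.
Proof.
rewrite mixture_with_zerosE orbit_mixture_setT diracT !mule1 -EFinD.
by congr EFin; lra.
Qed.

HB.instance Definition _ :=
  Measure_isProbability.Build _ _ _ mixture_with_zeros mixture_with_zeros_setT.

Lemma mixture_with_zeros_shift : shift_invariant mixture_with_zeros.
Proof.
move=> A mA; rewrite [LHS]mixture_with_zerosE [RHS]mixture_with_zerosE.
by rewrite (orbit_mixture_shift mA) !diracE.
Qed.

(** The measures could differ in positivity only on an open set containing [zeros]; such a set
    contains orbit points, which are atoms of the mixture. *)
Lemma msupport_mixture : msupport orbit_mixture = msupport mixture_with_zeros.
Proof.
suff E U : open U -> (0 < orbit_mixture U)%E = (0 < mixture_with_zeros U)%E.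
  by apply/seteqP; split => x h U oU Ux; have := h U oU Ux; rewrite E.
move=> oU; rewrite mixture_with_zerosE diracE.
have h2 : (0 < (1 / 2)%:E :> \bar R)%E by rewrite lte_fin divr_gt0.
have [mU|] := boolP (0 < orbit_mixture U)%E.
  apply/esym; apply: (lt_le_trans (mule_gt0 h2 mU)).
  by rewrite leeDl // mule_ge0 // ltW.
rewrite -leNgt => mU.
have -> : orbit_mixture U = 0%E by apply/eqP; rewrite eq_le mU measure_ge0.
rewrite mule0 add0e; have [Uz|nUz] := pselect (U zeros); last first.
  by rewrite memNset // mule0 ltxx.
exfalso; have [|N _ hN] := cvg_orbit_zeros (_ : nbhs zeros U).
  exact: open_nbhs_nbhs.
(* The shift 2^N is below the period, so it indexes an atom. *)
have iN : (2 ^ N < (2 ^ N.+1) ^ 2)%N by rewrite -expnM ltn_exp2l //; lia.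
by have := orbit_mixture_gt0 iN (hN N (leqnn N)); rewrite ltNge mU.
Qed.

End Mixtures.

(** * Growth rates of the pair under the two measures *)

Theorem theorem1p5 (R : realType) (H : completeNormedModType R)
    (ip : {dot H for idfun}) (e : int -> H)
    (hip : inner_product_norm ip) (he : orthonormal_basis ip e) :
  exists L : {linear H -> H} * {linear H -> H},
    calW e L /\
    exists mu nu : probability borelSigma2 R,
      [/\ shift_invariant mu, shift_invariant nu,
          msupport mu = msupport nu,
          maximising_measure L mu & ~ maximising_measure L nu].
Proof.
have wb x k : expR (-1) <= expR (weight x k : R) <= expR 1.
  by rewrite !ler_expR weight_ge weight_le1.
have [L1 [bL1 [iL1 L1e]]] := weighted_shift_exists hip he (wb false).
have [L2 [bL2 [iL2 L2e]]] := weighted_shift_exists hip he (wb true).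
exists (L1, L2); split.
  split; split => //=; [exists (fun k => expR (weight false k))|
    exists (fun k => expR (weight true k))]; by split=> // k; exact: expR_gt0.
set L := (L1, L2).
have ln_le := @ln_opnorm_le _ _ _ e hip he L bL1 bL2 L1e L2e.
pose g w := ln (opnorm (word_op L w)) : R.
have g_le Q n x : (0 < Q)%N -> g (word x n) <= Q%:R + n%:R / Q%:R.
  move=> Q0; apply: ln_le => k.
  by have := @log_weight_le R Q (word x n) k Q0; rewrite size_map size_iota.
have g_ge w k : log_weight w k <= g w :=
  @ln_opnorm_ge _ _ _ e hip he L bL1 bL2 L1e L2e w k.
have g_geN n x : - n%:R <= g (word x n).
  apply: le_trans (g_ge _ 0).
  by have := @log_weight_ge R (word x n) 0; rewrite size_map size_iota.
have g_bnd n x : `|g (word x n)| <= 1 + n%:R.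
  rewrite ler_norml; have := g_le 1%N n x isT; have := g_geN n x.
  by rewrite invr1 mulr1 => *; apply/andP; split; lra.
have rho0 :=
  @ln_joint_spectral_radius _ _ _ e hip he L bL1 bL2 L1e L2e.
exists orbit_mixture, mixture_with_zeros; split.
- exact: orbit_mixture_shift.
- exact: mixture_with_zeros_shift.
- exact: msupport_mixture.
- split; first exact: orbit_mixture_shift.
  rewrite rho0; apply: cvg0_sublinear => Q Q0.
  exists (Q%:R + (2 ^ Q)%:R) => n n0.
  have n0R : 0 < n%:R :> R by rewrite ltr0n.
  set I := (X in _ * X).
  suff : `|I| <= Q%:R + (2 ^ Q)%:R + n%:R / Q%:R.
    move=> h; rewrite normrM normfV (gtr0_norm n0R) mulrC ler_pdivrMr //.
    by rewrite mulrDl divfK ?gt_eqF // (mulrC Q%:R^-1).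
  have p2 : 0 <= (2 ^ Q)%:R :> R by rewrite ler0n.
  have Qr : 0 <= Q%:R :> R by rewrite ler0n.
  rewrite ler_norml; apply/andP; split; last first.
    (* Equal levels turn the two-level estimate into the uniform bound. *)
    have := @Rintegral_word_le R orbit_mixture n g _ (g_bnd n) (fun=> True)
      (Q%:R + n%:R / Q%:R) (Q%:R + n%:R / Q%:R) (fun x => g_le Q n x Q0)
      (fun x _ => g_le Q n x Q0).
    by rewrite subrr mul0r subr0 -/I => ?; lra.
  (* Orbits of scale at most 2^Q carry mass at least 1 - 2^-Q and satisfy g >= -2^Q. Elsewhere g >=
     -n - 2^Q, so the integral is at least -2^Q - n / 2^Q, hence at least -2^Q - n / Q. *)
  have := @Rintegral_word_ge R orbit_mixture n g _ (g_bnd n)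
    (fun w => - (2 ^ Q)%:R <= g w) (- n%:R - (2 ^ Q)%:R) (- (2 ^ Q)%:R).
  rewrite -/I => h; apply: le_trans (h _ _) => {h} //; last first.
    by move=> x; have := g_geN n x; lra.
  set m := fine _.
  have m_ge : 1 - (2 ^ Q)%:R^-1 <= m.
    rewrite -lee_fin fineK; last first.
      exact: fin_num_measure (orbit_mixture : probability _ R) _
        (measurable_word n (fun w => - (2 ^ Q)%:R <= g w)).
    apply: orbit_mixture_ge => p i pQ /=.
    have [k hk] := @log_weight_orbit R p.+1 i n isT.
    apply: le_trans (g_ge _ k); apply: le_trans hk.
    by rewrite lerN2 ler_nat leq_exp2l.
  have : n%:R * (1 - (2 ^ Q)%:R^-1) <= n%:R * m by rewrite ler_wpM2l.
  have : n%:R * (2 ^ Q)%:R^-1 <= n%:R * Q%:R^-1 :> R.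
    rewrite ler_wpM2l // lef_pV2 ?posrE ?ltr0n ?expn_gt0 // ler_nat.
    by rewrite ltnW // ltn_expl.
  by lra.
- move=> [_]; rewrite rho0 => /cvgr_to_le h.
  (* The bound 8 + n/8 everywhere and -n/2 on the word of zeros, of mass at least 1/2, give an
     integral of at most 4 - 3n/16, which is at most -n/8 once n >= 64. *)
  suff : (0 : R) <= - 8^-1 by lra.
  apply: h; exists 64%N => // n /= n64.
  have n0R : 0 < n%:R :> R by rewrite ltr0n (leq_trans _ n64).
  have n64R : 64 <= n%:R :> R by rewrite ler_nat.
  rewrite mulrC ler_pdivrMr //.
  have := @Rintegral_word_le R mixture_with_zeros n g _ (g_bnd n)
    (fun w => w = nseq n false) (8 + n%:R / 8) (- (n%:R / 2))
    (fun x => g_le 8%N n x isT).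
  move=> /(_ _)/le_trans; apply.
    move=> x ->; apply: ln_le => k.
    exact: log_weight_zeros.
  set m := fine _.
  have : 1 / 2 <= m.
    rewrite -lee_fin fineK; last first.
      exact: fin_num_measure (mixture_with_zeros : probability _ R) _
        (measurable_word n (fun w => w = nseq n false)).
    rewrite [leRHS]mixture_with_zerosE diracE mem_set /= ?word_zeros // mule1.
    by rewrite leeDr // mule_ge0 // lee_fin; lra.
  by nra.
Qed.
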